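(* Let $f:X\rightarrow Y$ be a continuous map of CAT(0) metric spaces, and suppose that $x,x'\in X$ satisfy $x\neq x'$ but $f(x)=f(x')$. Then the distance $d_X(x,x')$ is at least the sum of the distance from $x$ to the singular set for $f$ and the distance from $x'$ to the singular set for $f$.
   Context: The singular set for $f$ consists of all points of $X$ at which $f$ is not a local isometry, where $f$ is a local isometry at $z\in X$ if there is $r>0$ such that the restriction of $f$ to the ball of radius $r$ about $z$ is an isometry onto its image. The distance from a point to a subset is the infimum of the distances to points of the subset ($+\infty$ if the subset is empty). *)

(* Defs.v *)
From mathcomp Require Import all_boot all_order all_algebra.
From mathcomp Require Import all_classical all_reals all_analysis.

Set Implicit Arguments.
Unset Strict Implicit.
Unset Printing Implicit Defensive.

Import Order.TTheory GRing.Theory Num.Theory.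
Import numFieldNormedType.Exports.

Local Open Scope classical_set_scope.
Local Open Scope ring_scope.

(* The library norm on R * R is the sup norm, so the distance of the Euclidean
   plane is defined by hand. *)
Definition eucl2 (R : realType) (a b : R * R) : R :=
  Num.sqrt ((a.1 - b.1) ^+ 2 + (a.2 - b.2) ^+ 2).

Definition segment2 (R : realType) (a b : R * R) : set (R * R) :=
  [set ((1 - t) * a.1 + t * b.1, (1 - t) * a.2 + t * b.2) | t in `[0, 1]].

Section Geodesics.
Context {R : realType} {X : metricType R}.
Implicit Types (x y : X) (c : R -> X) (l : R) (S : set X).

(* Only the values of c on [0, l] matter. *)
Definition geodesic_path x y l c : Prop :=
  [/\ 0 <= l, c 0 = x, c l = y &
      {in `[0, l] &, forall s t, mdist (c s) (c t) = `|s - t|}].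

Definition geodesic_segment x y S : Prop :=
  exists l c, geodesic_path x y l c /\ S = c @` `[0, l].

(* The side S i joins the vertex v i to the vertex v (i + 1 mod 3). *)
Definition geodesic_triangle (v : 'I_3 -> X) (S : 'I_3 -> set X) : Prop :=
  forall i, geodesic_segment (v i) (v (ordS i)) (S i).

Definition comparison_triangle (v : 'I_3 -> X) (w : 'I_3 -> R * R) : Prop :=
  forall i j, eucl2 (w i) (w j) = mdist (v i) (v j).

(* The point a is a comparison point, on the side of the comparison triangle w
   from w i to w (i + 1 mod 3), for a point x of the corresponding side. *)
Definition comparison_point (v : 'I_3 -> X) (w : 'I_3 -> R * R) (i : 'I_3)
    x (a : R * R) : Prop :=
  segment2 (w i) (w (ordS i)) a /\ eucl2 (w i) a = mdist (v i) x.

Definition CAT0_inequality (v : 'I_3 -> X) (S : 'I_3 -> set X) : Prop :=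
  forall w, comparison_triangle v w ->
  forall (i j : 'I_3) x y (a b : R * R),
    S i x -> S j y ->
    comparison_point v w i x a -> comparison_point v w j y b ->
    mdist x y <= eucl2 a b.

End Geodesics.

Definition geodesic_space (R : realType) (X : metricType R) : Prop :=
  forall x y : X, exists S, geodesic_segment x y S.

(* Completeness is not part of the definition. *)
Definition CAT0 (R : realType) (X : metricType R) : Prop :=
  geodesic_space X /\
  forall (v : 'I_3 -> X) (S : 'I_3 -> set X),
    geodesic_triangle v S -> CAT0_inequality v S.

Section LocalIsometry.
Context {R : realType} {X Y : metricType R}.

Definition isometry_on (A : set X) (f : X -> Y) : Prop :=
  {in A &, forall a b, mdist (f a) (f b) = mdist a b}.

Definition local_isometry_at (f : X -> Y) (z : X) : Prop :=
  exists2 r : R, 0 < r & isometry_on (ball z r) f.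

Definition singular_set (f : X -> Y) : set X :=
  [set z | ~ local_isometry_at f z].

End LocalIsometry.

Lemma edist_mdist (R : realType) (X : metricType R) (x y : X) :
  edist (x, y) = (mdist x y)%:E.
Proof.
apply/eqP; rewrite eq_le; apply/andP; split.
  apply/lee_addgt0Pr => e e0; rewrite -EFinD; apply: edist_fin.
    by rewrite ltr_wpDl ?mdist_ge0.
  by rewrite ballEmdist /= ltrDl.
apply: le_ereal_inf_tmp => z /= [r [_]]; rewrite ballEmdist /= => xyr <-.
by rewrite lee_fin ltW.
Qed.

(* The library's edist_inf is the distance to a subset used in the statement. *)
Lemma edist_infE (R : realType) (X : metricType R) (A : set X) (x : X) :
  edist_inf A x = ereal_inf [set (mdist x a)%:E | a in A].
Proof.
rewrite /edist_inf; congr ereal_inf; apply: eq_imagel => a _.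
exact: edist_mdist.
Qed.

(* Main.v *)
(* A geodesic from x to x' must meet the singular set: otherwise f maps it to a
   local geodesic of Y, which is a geodesic because Y is CAT(0), and then
   f x <> f x'. A singular point z on the geodesic bounds the two distances by
   d(x, z) and d(z, x'), whose sum is d(x, x'). *)
Require Import Defs.
From mathcomp Require Import all_boot all_order all_algebra.
From mathcomp Require Import all_classical all_reals all_analysis.
From mathcomp Require Import ring lra.

Set Implicit Arguments.
Unset Strict Implicit.
Unset Printing Implicit Defensive.

Import Order.TTheory GRing.Theory Num.Theory.
Import numFieldNormedType.Exports.

Local Open Scope classical_set_scope.
Local Open Scope ring_scope.

Lemma eucl2_eq (R : realType) (a b : R * R) (d : R) : 0 <= d ->
  (a.1 - b.1) ^+ 2 + (a.2 - b.2) ^+ 2 = d ^+ 2 -> eucl2 a b = d.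
Proof. by move=> d0 abd; rewrite /eucl2 abd sqrtr_sqr ger0_norm. Qed.

Lemma eucl2C (R : realType) (a b : R * R) : eucl2 a b = eucl2 b a.
Proof. by rewrite /eucl2 -sqrrN opprB -[X in _ + X]sqrrN opprB. Qed.

Section Gluing.
Context {R : realType} {Y : metricType R}.
Implicit Types (c : R -> Y) (a b s t : R).

(** Arbitrary endpoints let overlapping pieces of one curve be glued without reparametrising,
    whereas a [geodesic_path] starts at 0. *)
Definition isometric_on_itv c a b : Prop :=
  {in `[a, b] &, forall s t, mdist (c s) (c t) = `|s - t|}.

Lemma isometric_on_itvP c a b :
  (forall s t, a <= s -> s <= t -> t <= b -> mdist (c s) (c t) = t - s) ->
  isometric_on_itv c a b.
Proof.
move=> H s t; rewrite !in_itv /= => /andP[as_ sb] /andP[at_ tb].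
have [st|/ltW ts] := leP s t.
  by rewrite distrC (ger0_norm (_ : 0 <= t - s)) ?subr_ge0// H.
by rewrite metric_sym (ger0_norm (_ : 0 <= s - t)) ?subr_ge0// H.
Qed.

Lemma isometric_on_itv_le c a b s t : isometric_on_itv c a b ->
  a <= s -> s <= t -> t <= b -> mdist (c s) (c t) = t - s.
Proof.
move=> H as_ st tb; rewrite H ?in_itv /= ?as_ ?tb ?andbT /=.
- by rewrite distrC ger0_norm ?subr_ge0.
- exact: le_trans tb.
- exact: le_trans st.
Qed.

(* In the comparison triangle the two sides at the vertex of q make a straight
   angle, because the comparison points at distance e from it are at distance at
   least 2 * e. *)
Lemma CAT0_geodesic_concat (hY : CAT0 Y) (p q r : Y) (l m e : R) c c' :
  geodesic_path p q l c -> geodesic_path q r m c' ->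
  0 < e -> e <= l -> e <= m -> mdist (c (l - e)) (c' e) = 2 * e ->
  mdist p r = l + m.
Proof.
move=> [l0 c0 cl cI] [m0 c'0 c'm c'I] e0 el em H.
have l1 : 0 < l by lra.
have m1 : 0 < m by lra.
have pq : mdist p q = l.
  by rewrite -c0 -cl (isometric_on_itv_le cI) ?subr0.
have qr : mdist q r = m.
  by rewrite -c'0 -c'm (isometric_on_itv_le c'I) ?subr0.
set d := mdist p r.
have dle : d <= l + m by rewrite -pq -qr; exact: metric_triangle.
have lle : l <= d + m by rewrite -pq -qr (metric_sym q r); exact: metric_triangle.
have mle : m <= l + d by rewrite -pq -qr (metric_sym p q); exact: metric_triangle.
have d0 : 0 <= d by exact: mdist_ge0.
(* Law of cosines: with [q] at the origin and [p] at [(l, 0)], [u] is the abscissa of the comparison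
   vertex of [r]. The triangle inequalities give [- m <= u <= m], so an ordinate [v] exists. *)
have [u uE] : exists u, 2 * l * u = l ^+ 2 + m ^+ 2 - d ^+ 2.
  by exists ((l ^+ 2 + m ^+ 2 - d ^+ 2) / (2 * l)); field; lra.
have um : u <= m.
  by rewrite -(ler_pM2l (_ : 0 < 2 * l)) ?uE; [nra | lra].
have mu : - m <= u.
  by rewrite -(ler_pM2l (_ : 0 < 2 * l)) ?uE; [nra | lra].
have [v vE] : exists v, v ^+ 2 = m ^+ 2 - u ^+ 2.
  by exists (Num.sqrt (m ^+ 2 - u ^+ 2)); rewrite sqr_sqrtr//; nra.
pose V (i : 'I_3) := match val i with 0%N => p | 1%N => q | _ => r end.
pose W (i : 'I_3) : R * R :=
  match val i with 0%N => (l, 0) | 1%N => (0, 0) | _ => (u, v) end.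
have [S3 hS3] := hY.1 r p.
pose S (i : 'I_3) := match val i with
  0%N => c @` `[0, l] | 1%N => c' @` `[0, m] | _ => S3 end.
have tri : geodesic_triangle V S.
  case=> [[|[|[|//]]] hi]; rewrite /S /V /=.
  - by exists l, c.
  - by exists m, c'.
  - exact: hS3.
have w01 : eucl2 (l, 0) (0, 0) = l :> R by apply: eucl2_eq => //=; ring.
have w12 : eucl2 (0, 0) (u, v) = m.
  by apply: eucl2_eq => //=; rewrite !sub0r !sqrrN vE; ring.
have w02 : eucl2 (l, 0) (u, v) = d.
  by apply: eucl2_eq => //=; rewrite sub0r sqrrN vE; lra.
have cmp : comparison_triangle V W.
  have w00 (a : R * R) : eucl2 a a = 0 by apply: eucl2_eq => //; ring.
  case=> [[|[|[|//]]] hi] [[|[|[|//]]] hj]; rewrite /V /W /= ?w00 ?mdistxx //.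
  - by rewrite w01.
  - by rewrite eucl2C w01 metric_sym.
  - by rewrite w12.
  - by rewrite eucl2C w02 metric_sym.
  - by rewrite eucl2C w12 metric_sym.
(* Scaling the side from [q] to [r] by [k] brings its length from [m] to [e], so [(k * u, k * v)] is
   the comparison point of [c' e]. *)
have [k kE] : exists k, k * m = e by exists (e / m); field; lra.
have k0 : 0 < k by rewrite -(pmulr_lgt0 _ m1) kE.
have k1 : k <= 1 by rewrite -(ler_pM2r m1) kE mul1r.
pose i0 : 'I_3 := @Ordinal 3 0 isT.
pose i1 : 'I_3 := @Ordinal 3 1 isT.
have Sx : S i0 (c (l - e)).
  by exists (l - e) => //=; rewrite in_itv /=; apply/andP; split; lra.
have Sy : S i1 (c' e).
  by exists e => //=; rewrite in_itv /=; apply/andP; split; lra.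
have Cx : comparison_point V W i0 (c (l - e)) (e, 0).
  split; rewrite /V /W /=.
    (* The side runs from [p] to [q], so distance [e] from the origin is parameter [1 - e / l]. *)
    exists (1 - e / l) => /=.
      have el1 : e / l <= 1 by rewrite ler_pdivrMr ?mul1r.
      have := divr_ge0 (ltW e0) l0; rewrite in_itv /= => el2.
      by apply/andP; split; lra.
    by congr pair; field; lra.
  have -> : mdist p (c (l - e)) = l - e.
    by rewrite -{1}c0 (isometric_on_itv_le cI) ?subr0//; lra.
  by apply: eucl2_eq => /=; [lra | ring].
have Cy : comparison_point V W i1 (c' e) (k * u, k * v).
  split; rewrite /V /W /=.
    by exists k => /=; [rewrite in_itv /= k1 ltW | rewrite !mulr0 !add0r].
  have -> : mdist q (c' e) = e.
    by rewrite -{1}c'0 (isometric_on_itv_le c'I) ?subr0//; lra.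
  apply: eucl2_eq => /=; first lra.
  by rewrite !sub0r !sqrrN !exprMn vE -kE; ring.
have := hY.2 _ _ tri _ cmp _ _ _ _ _ _ Sx Sy Cx Cy; rewrite H /eucl2 /=.
(* Squaring bounds [4 * e ^+ 2] by [(e - k * u) ^+ 2 + k ^+ 2 * (m ^+ 2 - u ^+ 2)], which is
   [2 * e ^+ 2 - 2 * e * k * u] because [k * m = e]. Hence [m <= - u]: the comparison angle at [q]
   is straight. *)
rewrite -(ler_sqr (_ : 2 * e \in Num.nneg)) ?nnegrE ?sqrtr_ge0//; last lra.
rewrite sqr_sqrtr; last by rewrite addr_ge0 ?sqr_ge0.
rewrite sub0r sqrrN (exprMn _ k v) vE => le1.
have le2 : 2 * (e * e) <= 2 * (e * (- (k * u))).
  have : (k * m) ^+ 2 = e ^+ 2 by rewrite kE.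
  by nra.
have le3 : k * m <= k * (- u).
  move: le2; rewrite ler_pM2l ?ltr0n// ler_pM2l// kE; lra.
move: le3; rewrite ler_pM2l// => le3.
(* With [m <= - u], the law of cosines [uE] yields [(l + m) ^+ 2 <= d ^+ 2]. *)
apply/eqP; rewrite eq_le dle /=.
by rewrite -(ler_pXn2r (n := 2)) ?nnegrE ?addr_ge0//; nra.
Qed.

(** Only [x < s < t < y] is at issue. There the pieces over [[x, t]] and [[t, y]] are geodesics
    meeting at [c t], and the overlap [[s, t]] makes their angle straight. *)
Lemma isometric_on_itv_glue (hY : CAT0 Y) c (a b s t : R) :
  s < t -> isometric_on_itv c a t -> isometric_on_itv c s b ->
  isometric_on_itv c a b.
Proof.
move=> st I1 I2; apply: isometric_on_itvP => x y ax xy yb.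
have [yt|ty] := leP y t; first exact: (isometric_on_itv_le I1).
have [sx|xs] := leP s x; first exact: (isometric_on_itv_le I2).
have xt := lt_trans xs st.
(* This choice keeps [t - e] and [t + e] inside [[s, b]], where [c] is isometric, so their images
   are [2 * e] apart. *)
pose e := Num.min (t - s) (y - t).
have e0 : 0 < e by rewrite /e lt_min !subr_gt0 st.
have es : e <= t - s by rewrite /e ge_min lexx.
have ey : e <= y - t by rewrite /e ge_min lexx orbT.
have -> : y - x = (t - x) + (y - t) by ring.
apply: (CAT0_geodesic_concat hY (q := c t) (c := fun z => c (x + z))
  (c' := fun z => c (t + z)) (e := e)) => //; last 1 first.
- by rewrite (isometric_on_itv_le I2); lra.
- split; rewrite ?addr0 //; [lra | by congr c; ring |].
  apply: isometric_on_itvP => z z' z0 zz' z'l.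
  by rewrite (isometric_on_itv_le I1); lra.
- split; rewrite ?addr0 //; [lra | by congr c; ring |].
  apply: isometric_on_itvP => z z' z0 zz' z'l.
  by rewrite (isometric_on_itv_le I2); lra.
- lra.
Qed.

(** Continuation argument: at the supremum of the [t] with [c] isometric on [[0, t]], gluing on a
    neighbourhood goes further unless [l] is reached. [Num.max] and [Num.min] clip neighbourhoods to
    [[0, l]]. *)
Lemma CAT0_local_geodesic (hY : CAT0 Y) c (l : R) : 0 <= l ->
  (forall t, 0 <= t <= l -> exists2 r : R, 0 < r &
     isometric_on_itv c (Num.max 0 (t - r)) (Num.min l (t + r))) ->
  isometric_on_itv c 0 l.
Proof.
move=> l0 loc.
pose E := [set t : R | 0 <= t <= l /\ isometric_on_itv c 0 t].
have E0 : E 0.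
  split; first by rewrite lexx.
  apply: isometric_on_itvP => s t s0 st t0.
  have -> : s = t by lra.
  by rewrite mdistxx subrr.
have ubE : ubound E l by move=> t [/andP[]].
have supE : has_sup E by split; [exists 0 | exists l].
have T0 : 0 <= sup E by apply: ub_le_sup => //; exists l.
have Tl : sup E <= l by apply: ge_sup => //; exists 0.
have [|r r0 I] := loc (sup E); first by rewrite T0.
have [t [/andP[t0 tl] It] tT] := sup_adherent r0 supE.
pose t1 := Num.min l (sup E + r).
have It1 : isometric_on_itv c 0 t1.
  (* Either the neighbourhood of [sup E] already starts at 0, or it overlaps [[0, t]] from
     [sup E - r] to [t]. *)
  have [Tr|Tr] := leP (sup E - r) 0.
    by move: I; rewrite max_l.
  apply: isometric_on_itv_glue It I => //.
  by rewrite gt_max tT; lra.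
have t1l : t1 <= l by rewrite /t1 ge_min lexx.
(* Since [sup E + r] exceeds [sup E], this forces [t1 = l]. *)
have : t1 <= sup E.
  apply: ub_le_sup; first by exists l.
  by split => //; rewrite t1l andbT /t1 le_min l0; lra.
rewrite /t1 ge_min => /orP[lT|]; last lra.
by move: It1; rewrite /t1 min_l//; lra.
Qed.

End Gluing.

Theorem lemma1p2 (R : realType) (X Y : metricType R) (f : X -> Y)
    (hX : CAT0 X) (hY : CAT0 Y) (hf : continuous f)
    (x x' : X) (hne : x != x') (hfx : f x = f x') :
  (edist_inf (singular_set f) x + edist_inf (singular_set f) x'
     <= (mdist x x')%:E)%E.
Proof.
have [_ [l [c [[l0 c0 cl cI] _]]]] := hX.1 x x'.
have xx' : mdist x x' = l.
  by rewrite -c0 -cl (isometric_on_itv_le cI) ?subr0.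
have [[t /andP[t0 tl] sing]|nosing] :=
    pselect (exists2 t : R, 0 <= t <= l & singular_set f (c t)).
  have xc : mdist x (c t) = t.
    by rewrite -c0 (isometric_on_itv_le cI) ?subr0.
  have x'c : mdist x' (c t) = l - t.
    by rewrite -cl metric_sym (isometric_on_itv_le cI).
  have -> : (mdist x x')%:E = (t%:E + (l - t)%:E)%E.
    by rewrite xx' -EFinD; congr (_%:E); ring.
  rewrite !edist_infE; apply: leeD; apply: ereal_inf_lbound; exists (c t) => //.
    by rewrite xc.
  by rewrite x'c.
have fI : isometric_on_itv (f \o c) 0 l.
  apply: CAT0_local_geodesic => // t /andP[t0 tl].
  have [r r0 fr] : local_isometry_at f (c t).
    by apply: contrapT => sing; apply: nosing; exists t => //; rewrite t0.
  (* Halving puts the closed interval of parameters inside the open ball of radius [r]. *)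
  exists (r / 2); first by rewrite divr_gt0.
  have B (y : R) : 0 <= y -> y <= l -> t - r / 2 <= y -> y <= t + r / 2 ->
      c y \in (ball (c t) r : set X).
    move=> y0 yl ty yt; rewrite inE ballEmdist /= cI ?in_itv /= ?t0 ?y0//.
    by rewrite ltr_norml; apply/andP; split; lra.
  apply: isometric_on_itvP => y z.
  rewrite ge_max le_min => /andP[y0 ty] yz /andP[zl zt] /=.
  rewrite fr; first by apply: (isometric_on_itv_le cI).
  - by apply: B; lra.
  - by apply: B; lra.
have : mdist (f x) (f x') = l.
  by rewrite -c0 -cl (isometric_on_itv_le fI) ?subr0.
by rewrite hfx mdistxx => l0'; move: hne; rewrite -mdist_gt0 xx' -l0' ltxx.
Qed.
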